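(* Let $(f,p):(F,A)_G\to(H,B)_K$ be a soft group homomorphism such that $F(x)=\operatorname{Ker} f$ for some $x\in A$. If $(f,p)$ is monic (a monomorphism in the category $SGp$ of soft groups), then $f$ and $p$ are injective.
   Context: A soft group $(F,A)_G$ over a group $G$ is a pair consisting of a set $A$ of parameters (a subset of some set $E$ of parameters) and a function $F:A\to P(G)$ into the power set of $G$ such that $F(a)$ is a subgroup of $G$ for every $a\in A$. For a group homomorphism $f:G\to K$, $\hat f:P(G)\to P(K)$ denotes the direct image map $\hat f(S)=f(S)$. A soft group homomorphism $(f,p):(F,A)_G\to(H,B)_K$ is a pair consisting of a group homomorphism $f:G\to K$ and a function $p:A\to B$ such that $\hat f\circ F=H\circ p$. Two soft group homomorphisms $(f,p)$ and $(g,q)$ are equal if and only if $f=g$ and $p=q$. $SGp$ is the category whose objects are soft groups (over arbitrary groups and parameter sets), whose morphisms are soft group homomorphisms, with componentwise composition $(g,q)\circ(f,p)=(g\circ f,q\circ p)$ and identities $(1_G,1_A)$. *)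

(* Defs.v *)
From HB Require Import structures.
From mathcomp Require Import all_boot.
From mathcomp Require Import boolp classical_sets.

Set Implicit Arguments.
Unset Strict Implicit.
Unset Printing Implicit Defensive.

Local Open Scope classical_set_scope.

Record category := Category {
  Ob :> Type;
  Hom : Ob -> Ob -> Type;
  idc : forall X, Hom X X;
  compc : forall X Y Z, Hom Y Z -> Hom X Y -> Hom X Z;
  compcA : forall X Y Z T (h : Hom Z T) (g : Hom Y Z) (f : Hom X Y),
    compc h (compc g f) = compc (compc h g) f;
  comp1c : forall X Y (f : Hom X Y), compc (idc Y) f = f;
  compc1 : forall X Y (f : Hom X Y), compc f (idc X) = f
}.

Definition monic (C : category) (X Y : C) (f : Hom X Y) : Prop :=
  forall (W : C) (g h : Hom W X), compc f g = compc f h -> g = h.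

Notation group_hom := UMagmaMorphism.type.

Section GroupHom.
Variables G K : groupType.

Lemma group_hom_eq (f g : group_hom G K) : f = g :> (G -> K) -> f = g.
Proof.
case: f g => [f [[fM] [f1]]] [g [[gM] [g1]]] /= fg; case: _ / fg in gM g1 *.
by rewrite (Prop_irrelevance gM fM) (Prop_irrelevance g1 f1).
Qed.

Definition direct_image (f : group_hom G K) : set G -> set K :=
  fun S => f @` S.

Definition ker (f : group_hom G K) : set G := [set g | f g = 1%g].

End GroupHom.

(* The parameter set is an arbitrary type: the ambient set E of which it is a
   subset plays no role.  It may be empty.  The choice structure required by
   groupType is no restriction on the group: boolp puts one on every type. *)
Record softGroup := SoftGroup {
  carrier : groupType;
  param : Type;
  soft_fun :> param -> set carrier;
  soft_funP : forall a, group_closed (mem (soft_fun a))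
}.

Record soft_hom (X Y : softGroup) := SoftHom {
  hom_fun : group_hom (carrier X) (carrier Y);
  param_fun : param X -> param Y;
  soft_homP : direct_image hom_fun \o X = Y \o param_fun
}.

Lemma soft_hom_eqP (X Y : softGroup) (u v : soft_hom X Y) :
  u = v <-> hom_fun u = hom_fun v /\ param_fun u = param_fun v.
Proof.
split=> [-> //|]; case: u v => [f p fp] [g q gq] /= [fg pq].
by case: _ / fg in gq *; case: _ / pq in gq *; rewrite (Prop_irrelevance gq fp).
Qed.

Section SoftGroupCategory.
Variables X Y Z : softGroup.

Fact soft_id_subproof :
  direct_image (idfun : group_hom (carrier X) (carrier X)) \o X = X \o idfun.
Proof. by apply/funext => a /=; rewrite /direct_image image_id. Qed.

Definition soft_id : soft_hom X X := SoftHom soft_id_subproof.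

Variables (v : soft_hom Y Z) (u : soft_hom X Y).

Fact soft_comp_subproof :
  direct_image (hom_fun v \o hom_fun u : group_hom (carrier X) (carrier Z)) \o X
  = Z \o (param_fun v \o param_fun u).
Proof.
apply/funext => a /=; rewrite /direct_image -image_comp.
have /(congr1 (@^~ a)) /= := soft_homP u; rewrite /direct_image => ->.
exact: (congr1 (@^~ (param_fun u a)) (soft_homP v)).
Qed.

Definition soft_comp : soft_hom X Z := SoftHom soft_comp_subproof.

End SoftGroupCategory.

Fact soft_compA (X Y Z T : softGroup)
    (w : soft_hom Z T) (v : soft_hom Y Z) (u : soft_hom X Y) :
  soft_comp w (soft_comp v u) = soft_comp (soft_comp w v) u.
Proof. by apply/soft_hom_eqP; split => //; apply: group_hom_eq. Qed.

Fact soft_comp1m (X Y : softGroup) (u : soft_hom X Y) :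
  soft_comp (soft_id Y) u = u.
Proof. by apply/soft_hom_eqP; split => //; apply: group_hom_eq. Qed.

Fact soft_compm1 (X Y : softGroup) (u : soft_hom X Y) :
  soft_comp u (soft_id X) = u.
Proof. by apply/soft_hom_eqP; split => //; apply: group_hom_eq. Qed.

Definition SGp : category := Category soft_compA soft_comp1m soft_compm1.

(* Main.v *)
Require Import Defs.
From HB Require Import structures.
From mathcomp Require Import all_boot.
From mathcomp Require Import boolp classical_sets.

Set Implicit Arguments.
Unset Strict Implicit.
Unset Printing Implicit Defensive.

(** Write [(f, p) : (F, A) -> (H, B)] for the morphism and [N] for the kernel
    of [f].  Monicity is tested against two soft groups with one parameter.

    For [f], the test object is the whole group [N * N]: its two projections,
    viewed as homomorphisms to the source of [f], both have image [N = F x], so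
    sending the parameter to [x] makes each of them a soft homomorphism.  Both
    become trivial after [f], hence they are equal, which forces every element
    of [N] to be [1] (compare the projections of [(k, 1)]).

    For [p], suppose [p a = p b].  Then [f(F a) = H (p a) = H (p b) = f(F b)],
    and since direct image along the injective [f] is injective, [F a = F b].
    So the subgroup [F a] over the source group maps to [(F, A)] by the identity
    in two ways, the parameter going to [a] or to [b]; these agree after
    [(f, p)], hence [a = b]. *)

Section KernelGroup.
Variables (G K : groupType) (f : group_hom G K).

(** The boolean form of [ker f], as the subtype construction demands. *)
Definition kerb : pred G := [pred g | f g == 1%g].

Lemma kerb_group_closed : group_closed kerb.
Proof.
split=> [|g h]; rewrite !inE ?gmulf1 // => /eqP fg /eqP fh.
by rewrite gmulfF fg fh divg1.
Qed.

Definition ker_group : Type := {g | kerb g}.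

HB.instance Definition _ := SubChoice.on ker_group.
HB.instance Definition _ :=
  SubChoice_isSubGroup.Build G kerb ker_group kerb_group_closed.

Lemma ker_groupP (k : ker_group) : f (val k) = 1%g.
Proof. by apply/eqP; exact: (valP k). Qed.

Definition ker_fst : group_hom (ker_group * ker_group)%type G :=
  (val : ker_group -> G) \o fst.

Definition ker_snd : group_hom (ker_group * ker_group)%type G :=
  (val : ker_group -> G) \o snd.

Lemma direct_image_ker_fst : direct_image ker_fst setT = ker f.
Proof.
apply/seteqP; split=> [_ [k _ <-]|g /eqP fg]; first exact: ker_groupP.
by exists (Sub g fg, 1%g); rewrite //= SubK.
Qed.

Lemma direct_image_ker_snd : direct_image ker_snd setT = ker f.
Proof.
apply/seteqP; split=> [_ [k _ <-]|g /eqP fg]; first exact: ker_groupP.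
by exists (1%g, Sub g fg); rewrite //= SubK.
Qed.

End KernelGroup.

Section PointSoftGroup.
Variables (G : groupType) (S : set G) (S_group : group_closed (mem S)).

Definition point_soft_group : softGroup :=
  @SoftGroup G unit (fun=> S) (fun=> S_group).

Lemma point_soft_homP (Y : softGroup) (f : group_hom G (carrier Y))
    (y : param Y) (f_S : direct_image f S = Y y) :
  direct_image f \o point_soft_group = Y \o (fun=> y).
Proof. exact/funext. Qed.

Definition point_soft_hom (Y : softGroup) (f : group_hom G (carrier Y))
    (y : param Y) (f_S : direct_image f S = Y y) :
    soft_hom point_soft_group Y :=
  SoftHom (point_soft_homP f_S).

(** A single parameter can be sent anywhere, so out of [point_soft_group] the
    group part and the parameter part of a soft homomorphism are linked only by
    the image of [S].  Monicity can thus be probed by varying either part. *)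
Lemma monic_point (X Y : softGroup) (u : soft_hom X Y)
    (g h : group_hom G (carrier X)) (a b : param X)
    (g_S : direct_image g S = X a) (h_S : direct_image h S = X b) :
  monic (C := SGp) u ->
  hom_fun u \o g =1 hom_fun u \o h -> param_fun u a = param_fun u b ->
  g = h /\ a = b.
Proof.
move=> u_monic ugh uab.
have /soft_hom_eqP[/= gh ab] : point_soft_hom g_S = point_soft_hom h_S.
  apply: u_monic; apply/soft_hom_eqP; split=> /=.
    exact/group_hom_eq/funext.
  by rewrite /comp /= uab.
by split=> //; exact: (congr1 (fun p : unit -> param X => p tt) ab).
Qed.

End PointSoftGroup.

Lemma group_closed_setT (G : groupType) : group_closed (mem (@setT G)).
Proof. by split=> [|g h _ _]; exact/mem_set. Qed.

(** Probing with all of [N * N] rather than with [N], the inclusion and the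
    trivial map, keeps both images equal to [N], so that the same parameter [x]
    serves both; the trivial map would need a parameter with value [1]. *)
Lemma monic_hom_injective (X Y : softGroup) (u : soft_hom X Y) (x : param X) :
  X x = ker (hom_fun u) -> monic (C := SGp) u -> injective (hom_fun u).
Proof.
move=> Xx u_monic; apply: gmulf_inj => g /eqP ug.
have [] := monic_point (group_closed_setT _)
  (etrans (direct_image_ker_fst (hom_fun u)) (esym Xx))
  (etrans (direct_image_ker_snd (hom_fun u)) (esym Xx)) u_monic.
- by move=> k; rewrite /= !ker_groupP.
- by [].
(* The two projections, taken at [(g, 1)], give [g = 1]. *)
- by move=> /(congr1 (fun e : group_hom _ _ => e (Sub g ug, 1%g))).
Qed.

(** Injectivity of the group part is what turns [H (p a) = H (p b)] back into
    [F a = F b], so that the identity can be paired with [a] and with [b]. *)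
Lemma monic_param_injective (X Y : softGroup) (u : soft_hom X Y) :
  injective (hom_fun u) -> monic (C := SGp) u -> injective (param_fun u).
Proof.
move=> u_inj u_monic a b uab.
have Xab : X a = X b.
  have uX c : direct_image (hom_fun u) (X c) = Y (param_fun u c).
    exact: (congr1 (@^~ c) (soft_homP u)).
  apply/funext => g; rewrite -!(image_inj u_inj).
  by rewrite -!/(direct_image _ _) !uX uab.
have id_a : direct_image (idfun : group_hom _ _) (X a) = X a := image_id _.
by have [] := monic_point (soft_funP a) id_a (etrans id_a Xab) u_monic
  (frefl _) uab.
Qed.

Theorem theorem3p6 (FA HB : softGroup) (fp : soft_hom FA HB)
    (x : param FA) (Fx_ker : FA x = ker (hom_fun fp))
    (fp_monic : monic (C := SGp) fp) :
  injective (hom_fun fp) /\ injective (param_fun fp).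
Proof.
have f_inj := monic_hom_injective Fx_ker fp_monic.
by split=> //; exact: monic_param_injective.
Qed.
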